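(* Consider the gas ($g$), electricity ($e$) and heat ($h$) market clearing problem with elementary orders, conversion orders and pro-rata constraints: $$\max_x\ \sum_{c\in\{g,e,h\}}\sum_{o\in\mathcal O^c}P_o^cQ_o^cx_o^c-\sum_{co\in\mathcal O^{g\to e}}P_{co}^{g\to e}Q_{co}^{g\to e}x_{co}^{g\to e}-\sum_{co\in\mathcal O^{g\to h}}P_{co}^{g\to h}Q_{co}^{g\to h}x_{co}^{g\to h}$$ subject to $$\sum_{o\in\mathcal O^g}Q_o^gx_o^g=-\sum_{co\in\mathcal O^{g\to e}}Q_{co}^{g\to e}x_{co}^{g\to e}-\sum_{co\in\mathcal O^{g\to h}}Q_{co}^{g\to h}x_{co}^{g\to h}\quad[\pi^g],$$ $$\sum_{o\in\mathcal O^e}Q_o^ex_o^e=\sum_{co\in\mathcal O^{g\to e}}\eta_{co}^{g\to e}Q_{co}^{g\to e}x_{co}^{g\to e}\quad[\pi^e],\qquad \sum_{o\in\mathcal O^h}Q_o^hx_o^h=\sum_{co\in\mathcal O^{g\to h}}\eta_{co}^{g\to h}Q_{co}^{g\to h}x_{co}^{g\to h}\quad[\pi^h],$$ $$x_{co_1}^{g\to e}=x_{co_2}^{g\to h}\quad\forall(co_1,co_2)\in\mathcal{PR},\qquad 0\le x_o^c\le1,\quad 0\le x_{co}^{g\to e}\le1,\quad 0\le x_{co}^{g\to h}\le1 .$$ Let $x$ be an optimal solution of this problem and let $\pi^g,\pi^e,\pi^h$ be market prices obtained as optimal dual variables of the three balance constraints. Then for each pair $(co_1,co_2)\in\mathcal{PR}$,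 the values $x_{co_1}^{g\to e},x_{co_2}^{g\to h}$ of this solution also solve the profit maximising program of the market participant with this pro-rata constraint facing the market prices $\pi^g,\pi^e,\pi^h$: $$\max_{x_{co_1}^{g\to e},\,x_{co_2}^{g\to h}}\ \big((\eta_{co_1}^{g\to e}\pi^e-\pi^g)-P_{co_1}^{g\to e}\big)Q_{co_1}^{g\to e}x_{co_1}^{g\to e}+\big((\eta_{co_2}^{g\to h}\pi^h-\pi^g)-P_{co_2}^{g\to h}\big)Q_{co_2}^{g\to h}x_{co_2}^{g\to h}$$ subject to $x_{co_1}^{g\to e}\le1$, $x_{co_2}^{g\to h}\le1$, $x_{co_1}^{g\to e}=x_{co_2}^{g\to h}$, $x_{co_1}^{g\to e}\ge0$, $x_{co_2}^{g\to h}\ge0$.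
   Context: For each carrier $c\in\{g,e,h\}$, $\mathcal O^c$ is a finite set of elementary orders; order $o$ has limit price $P_o^c\in\mathbb R$, quantity $Q_o^c\in\mathbb R$ ($<0$ for sell, $>0$ for buy) and acceptance ratio $x_o^c$. $\mathcal O^{g\to e}$ and $\mathcal O^{g\to h}$ are finite sets of gas-to-electricity and gas-to-heat conversion orders, with conversion prices $P_{co}$, capacities $Q_{co}>0$, efficiencies $\eta_{co}>0$ and acceptance ratios $x_{co}$ (with the corresponding superscript). $\mathcal{PR}\subseteq\mathcal O^{g\to e}\times\mathcal O^{g\to h}$ is the set of pro-rata constraints: each pair consists of the two conversion orders of one market participant (e.g. a back-pressure combined heat and power unit), and each conversion order belongs to at most one pair. Sign convention for dual variables: $(\pi^g,\pi^e,\pi^h)$ are optimal dual variables of the balance constraints if they minimise over $\mathbb R^3$ the dual function $\pi\mapsto\max_x\{\text{objective}(x)-\sum_{c}\pi^c(\text{left-hand side minus right-hand side of the balance constraint of carrier }c)\}$, the maximum being over $x$ satisfying all constraints other than the balance constraints (equivalently, $\pi$ is the corresponding component of an optimal solution of the linear programming dual). *)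

(* Defs.v *)
From mathcomp Require Import all_boot all_order all_algebra.
From mathcomp Require Import reals.

Set Implicit Arguments.
Unset Strict Implicit.
Unset Printing Implicit Defensive.

Import Order.TTheory GRing.Theory Num.Theory.
Local Open Scope ring_scope.

Section Optimization.
Context {R : realType} {T : Type}.
Implicit Types (S : T -> Prop) (f : T -> R).

Definition maximizer S f (x : T) : Prop :=
  S x /\ forall y, S y -> f y <= f x.

Definition maximum S f (v : R) : Prop :=
  exists2 x, maximizer S f x & f x = v.

End Optimization.

Inductive carrier := gas | elec | heat.

Definition sum_carriers (R : realType) (F : carrier -> R) : R :=
  F gas + F elec + F heat.

(* [ge] and [gh] stand for gas-to-electricity and gas-to-heat. The sign of an
   elementary order's quantity tells its side (negative: sell, positive: buy).
   A pair of [pro_rata] gathers the two conversion orders of one participant. *)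
Record market (R : realType) := Market {
  order : carrier -> finType;
  price : forall c, order c -> R;
  quantity : forall c, order c -> R;

  ge_order : finType;
  ge_price : ge_order -> R;
  ge_capacity : ge_order -> R;
  ge_efficiency : ge_order -> R;

  gh_order : finType;
  gh_price : gh_order -> R;
  gh_capacity : gh_order -> R;
  gh_efficiency : gh_order -> R;

  pro_rata : {set ge_order * gh_order};

  ge_capacity_gt0 : forall co, 0 < ge_capacity co;
  gh_capacity_gt0 : forall co, 0 < gh_capacity co;
  ge_efficiency_gt0 : forall co, 0 < ge_efficiency co;
  gh_efficiency_gt0 : forall co, 0 < gh_efficiency co;
  pro_rata_inj1 : {in pro_rata &, injective fst};
  pro_rata_inj2 : {in pro_rata &, injective snd}
}.

Arguments price {R m c} _.
Arguments quantity {R m c} _.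
Arguments ge_price {R m} _.
Arguments ge_capacity {R m} _.
Arguments ge_efficiency {R m} _.
Arguments gh_price {R m} _.
Arguments gh_capacity {R m} _.
Arguments gh_efficiency {R m} _.

(* The acceptance ratios of all the orders. *)
Record allocation (R : realType) (M : market R) := Allocation {
  ratio : forall c, order M c -> R;
  ge_ratio : ge_order M -> R;
  gh_ratio : gh_order M -> R
}.

Arguments ratio {R M} _ {c} _.

Section Clearing.
Context {R : realType} (M : market R).
Implicit Types (x : allocation M) (pi : carrier -> R).

Definition objective x : R :=
  sum_carriers (fun c =>
    \sum_(o : order M c) price o * quantity o * ratio x o)
  - \sum_(co : ge_order M) ge_price co * ge_capacity co * ge_ratio x co
  - \sum_(co : gh_order M) gh_price co * gh_capacity co * gh_ratio x co.

Definition balance_lhs x (c : carrier) : R :=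
  \sum_(o : order M c) quantity o * ratio x o.

Definition balance_rhs x (c : carrier) : R :=
  match c with
  | gas => - (\sum_(co : ge_order M) ge_capacity co * ge_ratio x co)
           - \sum_(co : gh_order M) gh_capacity co * gh_ratio x co
  | elec => \sum_(co : ge_order M)
              ge_efficiency co * ge_capacity co * ge_ratio x co
  | heat => \sum_(co : gh_order M)
              gh_efficiency co * gh_capacity co * gh_ratio x co
  end.

Definition balanced x : Prop := forall c, balance_lhs x c = balance_rhs x c.

Definition non_balance_constraints x : Prop :=
  [/\ forall p, p \in pro_rata M -> ge_ratio x p.1 = gh_ratio x p.2,
      forall c (o : order M c), 0 <= ratio x o <= 1,
      forall co, 0 <= ge_ratio x co <= 1
    & forall co, 0 <= gh_ratio x co <= 1].

Definition market_feasible x : Prop :=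
  balanced x /\ non_balance_constraints x.

Definition optimal_solution x : Prop := maximizer market_feasible objective x.

Definition lagrangian pi x : R :=
  objective x
  - sum_carriers (fun c => pi c * (balance_lhs x c - balance_rhs x c)).

(* The graph of the dual function. It is a total function of [pi]: an affine
   function attains its maximum on the nonempty compact polytope
   [non_balance_constraints]. *)
Definition dual_value pi (v : R) : Prop :=
  maximum non_balance_constraints (lagrangian pi) v.

Definition optimal_prices pi : Prop :=
  exists2 v, dual_value pi v &
    forall pi' v', dual_value pi' v' -> v <= v'.

Section Participant.
Variables (pi : carrier -> R) (co1 : ge_order M) (co2 : gh_order M).

(* The first component is the ratio of [co1], the second that of [co2]. *)
Definition participant_profit (y : R * R) : R :=
  ((ge_efficiency co1 * pi elec - pi gas) - ge_price co1)
    * ge_capacity co1 * y.1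
  + ((gh_efficiency co2 * pi heat - pi gas) - gh_price co2)
    * gh_capacity co2 * y.2.

Definition participant_feasible (y : R * R) : Prop :=
  [/\ y.1 <= 1, y.2 <= 1, y.1 = y.2, 0 <= y.1 & 0 <= y.2].

Definition solves_participant_program (y : R * R) : Prop :=
  maximizer participant_feasible participant_profit y.

End Participant.

End Clearing.

(* Main.v *)
(** By linear programming duality the optimal prices [pi] have dual value
    [objective x], so [x] maximises the Lagrangian at [pi] over the constraints
    other than the balances. The Lagrangian is separable: moving only the common
    ratio of a pro-rata pair changes it by the change in profit of that
    participant, and such a move violates no other constraint, because the two
    orders belong to no other pair. *)

From mathcomp Require Import all_boot all_order all_algebra.
From mathcomp Require Import reals boolp ring lra.
Require Import Defs.

Set Implicit Arguments.
Unset Strict Implicit.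
Unset Printing Implicit Defensive.

Import Order.TTheory GRing.Theory Num.Theory.
Local Open Scope ring_scope.

(* [comb v a w] stands for [v + a w]. Linear forms need no other structure on
   [V], so that the record type [allocation M] can be used for [V]. *)
Record linform (R : realFieldType) (V : Type) (comb : V -> R -> V -> V) :=
  LinForm {
  form :> V -> R;
  form_comb : forall v a w, form (comb v a w) = form v + a * form w
}.

(** * Farkas' lemma for linear forms over a bare combination operation *)

Section Farkas.
Context {R : realFieldType} {V : Type} {comb : V -> R -> V -> V}.
Local Notation linform := (linform comb).
Implicit Types (f g : linform) (s : seq linform) (v w : V).

Definition nonneg s v : bool := all (fun f : linform => 0 <= f v) s.

Lemma nonneg_cons f s v : nonneg (f :: s) v = (0 <= f v) && nonneg s v.
Proof. by []. Qed.

(** Membership of [g] in the convex cone generated by [s], peeling off one multiplier at a time. As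
    [g] is a plain function, the remainders need not be packaged as forms. *)
Fixpoint conic s (g : V -> R) : Prop :=
  if s is f :: s' then exists2 y, 0 <= y & conic s' (fun v => g v - y * f v)
  else forall v, g v = 0.

Lemma conic_ge0 s (g : V -> R) v : conic s g -> nonneg s v -> 0 <= g v.
Proof.
elim: s g => [|f s IHs] g; first by move=> ->.
rewrite nonneg_cons => -[y y_ge0 /IHs gE] /andP[fv_ge0 /gE].
by have := mulr_ge0 y_ge0 fv_ge0; lra.
Qed.

Fact shear_comb f0 w f v a u :
  let F z := f z + f w / - f0 w * f0 z in F (comb v a u) = F v + a * F u.
Proof. by rewrite /= !form_comb; ring. Qed.

(* If [f0 w != 0] this is the composition of [f] with the projection along [w]
   onto the kernel of [f0]. *)
Definition shear f0 w f : linform := LinForm (shear_comb f0 w f).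

Lemma shearE f0 w f v : shear f0 w f v = f (comb v (f0 v / - f0 w) w).
Proof. by rewrite form_comb /=; ring. Qed.

(** Each sheared form is [f] plus a multiple of [f0], nonnegative because [f w >= 0] and
    [- f0 w > 0]; these multiples accumulate in [k]. *)
Lemma conic_shear f0 w s (g : V -> R) : f0 w < 0 -> nonneg s w ->
  conic (map (shear f0 w) s) g ->
  exists2 k, 0 <= k & conic s (fun v => g v - k * f0 v).
Proof.
move=> f0w_lt0; elim: s g => [|f s IHs] g /=.
  by move=> _ g0; exists 0 => // v; rewrite g0 mul0r subr0.
move=> /andP[fw_ge0 sw_ge0] [y y_ge0 /(IHs _ sw_ge0)[k k_ge0 gk]].
exists (k + y * (f w / - f0 w)).
  by rewrite addr_ge0 // mulr_ge0 // divr_ge0 // oppr_ge0 ltW.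
exists y => //; congr conic: gk; apply/funext => v /=; ring.
Qed.

(* Bartl's proof: if the last form [f0] is needed, some [w] violates it and
   satisfies the others; projecting along [w] onto the kernel of [f0] eliminates
   [f0]. *)
Lemma farkas s g : (forall v, nonneg s v -> 0 <= g v) -> conic s g.
Proof.
move: {2}(size s) (erefl (size s)) => n; elim: n s g => [|n IHn] [|f0 s] //= g.
  (* [comb v (- 2%:R) v] stands for [- v], so [g] is nonnegative at both [v] and [- v]. *)
  move=> _ g_ge0 v; have := g_ge0 v isT; have := g_ge0 (comb v (- 2%:R) v) isT.
  by rewrite form_comb; lra.
move=> [sz_s] g_ge0.
have [g_ge0s|] := EM (forall v, nonneg s v -> 0 <= g v).
  exists 0 => //; have := IHn s g sz_s g_ge0s; congr conic.
  by apply/funext => v; rewrite mul0r subr0.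
move=> /existsNP[w /not_implyP[sw_ge0 /negP]]; rewrite -ltNge => gw_lt0.
have f0w_lt0 : f0 w < 0.
  by rewrite ltNge; apply/negP => f0w; have := g_ge0 w; rewrite f0w sw_ge0; lra.
have [|k k_ge0 gk] := @conic_shear f0 w s (shear f0 w g) f0w_lt0 sw_ge0.
  apply: IHn => [|v]; first by rewrite size_map.
  rewrite /nonneg all_map => sv_ge0.
  suff : nonneg (f0 :: s) (comb v (f0 v / - f0 w) w).
    by move=> /g_ge0; rewrite -shearE.
  apply/andP; split.
    by rewrite form_comb invrN mulrN mulNr divfK ?subrr // lt_eqF.
  by apply: sub_all sv_ge0 => f; rewrite -shearE.
(* Shearing [g] subtracts [g w / f0 w] times [f0], a positive multiple since both values at [w] are
   negative. *)
exists (k + g w / f0 w).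
  by rewrite addr_ge0 // mulr_le0 ?invr_le0 // ltW.
congr conic: gk; apply/funext => v /=; rewrite invrN; ring.
Qed.

(** * Polyhedral sets and their closure properties *)

Definition polyhedral (C : V -> Prop) : Prop :=
  exists hs : seq (linform * R),
    forall v, C v <-> all (fun h : linform * R => h.2 <= h.1 v) hs.

Lemma polyhedral_ge f b : polyhedral (fun v => b <= f v).
Proof. by exists [:: (f, b)] => v /=; rewrite andbT. Qed.

Lemma polyhedralT : polyhedral (fun=> True).
Proof. by exists [::]. Qed.

Lemma polyhedral_iff (C D : V -> Prop) :
  (forall v, C v <-> D v) -> polyhedral C -> polyhedral D.
Proof. by move=> CD [hs Chs]; exists hs => v; rewrite -CD. Qed.

Lemma polyhedralI (C D : V -> Prop) :
  polyhedral C -> polyhedral D -> polyhedral (fun v => C v /\ D v).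
Proof.
move=> [hs Chs] [ks Dks]; exists (hs ++ ks) => v.
by rewrite all_cat Chs Dks; split=> [[-> ->]//|/andP].
Qed.

Lemma polyhedral_forall (I : finType) (C : I -> V -> Prop) :
  (forall i, polyhedral (C i)) -> polyhedral (fun v => forall i, C i v).
Proof.
move=> Cpoly; suff [hs Chs] :
    polyhedral (fun v => forall i, i \in enum I -> C i v).
  exists hs => v; rewrite -Chs.
  by split=> Cv i => [_|]; apply: Cv; rewrite mem_enum.
elim: (enum I) => [|i s IHs]; first exact: polyhedral_iff polyhedralT.
apply: polyhedral_iff (polyhedralI (Cpoly i) IHs) => v; split.
  by move=> [Civ Csv] j; rewrite inE => /predU1P[->//|/Csv].
by move=> Cv; split=> [|j js]; apply: Cv; rewrite inE ?eqxx ?js ?orbT.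
Qed.

Fact add_form_comb a f g v b w :
  let F z := f z + a * g z in F (comb v b w) = F v + b * F w.
Proof. by rewrite /= !form_comb; ring. Qed.

Definition add_form a f g : linform := LinForm (add_form_comb a f g).

Definition opp_form f : linform := add_form (- 2%:R) f f.

Lemma opp_formE f v : opp_form f v = - f v.
Proof. by rewrite /=; ring. Qed.

Lemma polyhedral_le f b : polyhedral (fun v => f v <= b).
Proof.
apply: polyhedral_iff (polyhedral_ge (opp_form f) (- b)) => v.
by rewrite opp_formE lerN2.
Qed.

Lemma polyhedral_eq f b : polyhedral (fun v => f v = b).
Proof.
apply: polyhedral_iff (polyhedralI (polyhedral_ge f b) (polyhedral_le f b)) => v.
by split=> [[fv_ge fv_le]|->//]; apply: le_anti; rewrite fv_ge fv_le.
Qed.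

End Farkas.

Arguments polyhedral {R V} comb C.

(** * Lagrange multiplier of one linear equality over a polyhedral set *)

Section Lagrange.
Context {R : realType} {V : Type} {comb : V -> R -> V -> V}.
Local Notation linform := (linform comb).
Implicit Types (E f g : linform) (C : V -> Prop).

Definition hcomb (p : V * R) (a : R) (q : V * R) : V * R :=
  (comb p.1 a q.1, p.2 + a * q.2).

Fact homogenize_comb (h : linform * R) p a q :
  let F z := h.1 z.1 - h.2 * z.2 in F (hcomb p a q) = F p + a * F q.
Proof. by rewrite /= form_comb; ring. Qed.

Definition homogenize (h : linform * R) := LinForm (homogenize_comb h).

Lemma nonneg_homogenize hs p :
  nonneg (map homogenize hs) p =
  all (fun h : linform * R => h.2 * p.2 <= h.1 p.1) hs.
Proof.
by rewrite /nonneg all_map; apply: eq_all => h /=; rewrite subr_ge0.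
Qed.

Fact snd_form_comb (p : V * R) a q :
  snd (hcomb p a q) = p.2 + a * q.2.
Proof. by []. Qed.

Definition snd_form := LinForm snd_form_comb.

(* Farkas' lemma is applied to the homogenisation of [C]: a point [(v, t)] of
   it stands for [v / t] if [0 < t], and for a direction of recession of [C]
   if [t = 0]. *)
Lemma lagrange_multiplier C E g x : polyhedral comb C ->
    maximizer (fun v => C v /\ E v = 0) g x ->
  exists mu, maximizer C (add_form mu g E) x.
Proof.
move=> [hs Chs] [[Cx Ex] gx_max].
pose Eh := homogenize (E, 0).
have : conic [:: Eh, opp_form Eh, snd_form & map homogenize hs]
             (opp_form (homogenize (g, g x))).
  apply: farkas => -[v t]; rewrite !nonneg_cons nonneg_homogenize => /and4P[].
  rewrite !opp_formE /= mul0r subr0 => Ev_ge0 Ev_le0 t_ge0 hv.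
  have Ev0 : E v = 0 by apply: le_anti; rewrite Ev_ge0 -oppr_ge0 Ev_le0.
  move: t_ge0; rewrite le_eqVlt => /predU1P[t0|t_gt0].
    (* Optimality of [x] against the feasible point [x + v] gives [g v <= 0]. *)
    have /gx_max : C (comb x 1 v) /\ E (comb x 1 v) = 0.
      rewrite form_comb Ex Ev0 mulr0 addr0; split => //.
      apply/Chs; move/Chs: Cx => Cx; have := conj hv Cx => /andP.
      rewrite -all_predI; apply: sub_all => h /andP[/=].
      by rewrite form_comb -t0; lra.
    by rewrite form_comb -t0; lra.
  have scale f : f (comb v (t^-1 - 1) v) = f v / t by rewrite form_comb; ring.
  have /gx_max : C (comb v (t^-1 - 1) v) /\ E (comb v (t^-1 - 1) v) = 0.
    rewrite scale Ev0 mul0r; split => //.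
    by apply/Chs; apply: sub_all hv => h; rewrite scale ler_pdivlMr.
  by rewrite scale ler_pdivrMr //; lra.
(* The multipliers of [Eh] and of its opposite merge into one of free sign. Evaluating the conic
   combination at [(z, 1)] gives [g z + (y1 - y2) * E z + y3 <= g x]. *)
move=> [y1 _ [y2 _ [y3 y3_ge0 gE]]]; exists (y1 - y2); split => // z Cz.
have hz : nonneg (map homogenize hs) (z, 1).
  rewrite nonneg_homogenize; move/Chs: Cz; apply: sub_all => h /=; lra.
have := conic_ge0 gE hz; rewrite /= Ex; lra.
Qed.

End Lagrange.

(** * Market clearing as a linear program *)

Lemma sum_comb (R : comPzRingType) (I : finType) (k f g : I -> R) (a : R) :
  \sum_i k i * (f i + a * g i) = \sum_i k i * f i + a * \sum_i k i * g i.
Proof.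
by rewrite mulr_sumr -big_split; apply: eq_bigr => i _ /=; ring.
Qed.

Lemma sum_delta (R : pzRingType) (I : finType) (k : I -> R) (i0 : I) :
  \sum_i k i * (i == i0)%:R = k i0.
Proof.
rewrite (bigD1 i0) //= eqxx mulr1 big1 ?addr0 // => i /negPf->.
by rewrite mulr0.
Qed.

Section Clearing.
Context {R : realType} (M : market R).
Implicit Types (x y : allocation M) (pi : carrier -> R).

Definition alloc_comb x (a : R) y : allocation M :=
  Allocation (fun c (o : order M c) => ratio x o + a * ratio y o)
             (fun co => ge_ratio x co + a * ge_ratio y co)
             (fun co => gh_ratio x co + a * gh_ratio y co).

Local Notation linform := (linform alloc_comb).

Fact objective_comb x a y :
  objective (alloc_comb x a y) = objective x + a * objective y.
Proof. by rewrite /objective /sum_carriers /= !sum_comb; ring. Qed.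

Definition objective_form : linform := LinForm objective_comb.

Definition imbalance c x : R := balance_lhs x c - balance_rhs x c.

Fact imbalance_comb c x a y :
  imbalance c (alloc_comb x a y) = imbalance c x + a * imbalance c y.
Proof.
by rewrite /imbalance /balance_lhs; case: c => /=; rewrite !sum_comb; ring.
Qed.

Definition imbalance_form c : linform := LinForm (imbalance_comb c).

Lemma lagrangian_comb pi x a y :
  lagrangian pi (alloc_comb x a y) = lagrangian pi x + a * lagrangian pi y.
Proof.
rewrite /lagrangian /sum_carriers -!/(imbalance _ _) objective_comb.
by rewrite !imbalance_comb; ring.
Qed.

Definition ratio_form c (o : order M c) : linform :=
  @LinForm _ _ alloc_comb (fun x => ratio x o) (fun _ _ _ => erefl).

Definition ge_form co : linform :=
  @LinForm _ _ alloc_comb (fun x => ge_ratio x co) (fun _ _ _ => erefl).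

Definition gh_form co : linform :=
  @LinForm _ _ alloc_comb (fun x => gh_ratio x co) (fun _ _ _ => erefl).

Lemma polyhedral_unit_interval (f : linform) :
  polyhedral alloc_comb (fun x => 0 <= f x <= 1).
Proof.
apply: polyhedral_iff (polyhedralI (polyhedral_ge f 0) (polyhedral_le f 1)) => x.
by split=> [[-> ->]|/andP].
Qed.

Lemma polyhedral_non_balance :
  polyhedral alloc_comb (@non_balance_constraints R M).
Proof.
have pairs : polyhedral alloc_comb (fun x =>
    forall p, p \in pro_rata M -> ge_ratio x p.1 = gh_ratio x p.2).
  apply: polyhedral_forall => p; case: (p \in _); last first.
    by apply: polyhedral_iff polyhedralT.
  apply: polyhedral_iff
    (polyhedral_eq (add_form (- 1) (ge_form p.1) (gh_form p.2)) 0) => x /=.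
  by rewrite mulN1r; split=> [/subr0_eq->//|->//]; rewrite subrr.
have elementary c := polyhedral_forall (fun o : order M c =>
  polyhedral_unit_interval (ratio_form o)).
have ge := polyhedral_forall (fun co => polyhedral_unit_interval (ge_form co)).
have gh := polyhedral_forall (fun co => polyhedral_unit_interval (gh_form co)).
(* [carrier] is not declared as a [finType], so its three cases are intersected by hand. *)
apply: polyhedral_iff (polyhedralI pairs (polyhedralI (polyhedralI
  (elementary gas) (polyhedralI (elementary elec) (elementary heat)))
  (polyhedralI ge gh))) => x /=.
split=> [[px [[gx [ex hx]] [gex ghx]]]|[px ox gex ghx]]; first by split=> // -[].
by split=> //; split=> //; do ?split=> //; exact: ox.
Qed.

(** The balances are dualised one at a time (heat, electricity, gas); those not yet dualised stay
    among the polyhedral constraints. *)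
Lemma strong_duality x : optimal_solution x ->
  exists pi, maximizer (@non_balance_constraints R M) (lagrangian pi) x.
Proof.
move=> [[bal_x nbx] x_max].
have poly c : polyhedral alloc_comb (fun z => imbalance_form c z = 0) :=
  polyhedral_eq (imbalance_form c) 0.
have imb_x c : imbalance_form c x = 0 by rewrite /= /imbalance bal_x subrr.
have max0 : maximizer (fun z => ((non_balance_constraints z /\
    imbalance_form gas z = 0) /\ imbalance_form elec z = 0) /\
    imbalance_form heat z = 0) objective_form x.
  split=> // z [[[nbz gz] ez] hz]; apply: x_max; split=> // c.
  by apply/subr0_eq; case: c.
have [mu_h max1] := lagrange_multiplier
  (polyhedralI (polyhedralI polyhedral_non_balance (poly gas)) (poly elec)) max0.
have [mu_e max2] := lagrange_multiplier
  (polyhedralI polyhedral_non_balance (poly gas)) max1.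
have [mu_g [_ max3]] := lagrange_multiplier polyhedral_non_balance max2.
(* The signs flip because [lagrangian] subtracts the priced imbalances. *)
exists (fun c => match c with gas => - mu_g | elec => - mu_e | heat => - mu_h end).
split=> // z /max3 /=; rewrite /lagrangian /sum_carriers /imbalance; lra.
Qed.

Lemma lagrangian_optimal pi x : optimal_solution x -> optimal_prices M pi ->
  maximizer (@non_balance_constraints R M) (lagrangian pi) x.
Proof.
move=> x_opt [v [xbar [_ xbar_max] <-] v_min].
have [pi0 x_max0] := strong_duality x_opt; have [[bal_x nbx] _] := x_opt.
have lagr_x pi' : lagrangian pi' x = objective x.
  by rewrite /lagrangian /sum_carriers !bal_x !subrr !mulr0 !addr0 subr0.
(* The chain is [lagrangian pi z <= v <= lagrangian pi0 x = objective x = lagrangian pi x], the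
   second inequality by minimality of [v]. *)
split=> // z /xbar_max /le_trans; apply; rewrite lagr_x -(lagr_x pi0).
by apply: (v_min pi0); exists x.
Qed.

(** Used as a direction: adding a multiple of it moves the two ratios of a pair together. *)
Definition pair_alloc (co1 : ge_order M) (co2 : gh_order M) : allocation M :=
  Allocation (fun c (o : order M c) => 0)
             (fun co => (co == co1)%:R) (fun co => (co == co2)%:R).

(** By linearity this is the slope of the Lagrangian along that direction. *)
Lemma lagrangian_pair_alloc pi co1 co2 :
  lagrangian pi (pair_alloc co1 co2) = participant_profit pi co1 co2 (1, 1).
Proof.
rewrite /lagrangian /participant_profit /objective /sum_carriers /balance_lhs /=.
have sum0 (I : finType) (k : I -> R) : \sum_i k i * 0 = 0.
  by rewrite -mulr_suml mulr0.
by rewrite !sum_delta !sum0; ring.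
Qed.

Lemma pair_alloc_feasible co1 co2 x t : (co1, co2) \in pro_rata M ->
  non_balance_constraints x -> 0 <= t <= 1 ->
  non_balance_constraints
    (alloc_comb x (t - ge_ratio x co1) (pair_alloc co1 co2)).
Proof.
move=> pr [px ox gex ghx] t01; split=> /=.
- move=> p p_pr; rewrite px //; congr (_ + _ * _%:R).
  (* Both ratios of a pair [p] shift equally, since [p] contains [co1] exactly when it contains
     [co2]. *)
  suff -> : (p.1 == co1) = (p.2 == co2) by [].
  apply/eqP/eqP => E.
    by rewrite (pro_rata_inj1 p_pr pr E).
  by rewrite (pro_rata_inj2 p_pr pr E).
- by move=> c o; rewrite mulr0 addr0.
- by move=> co; case: eqP => [->|_]; rewrite ?mulr1 ?subrKC // mulr0 addr0.
- move=> co; case: eqP => [->|_]; last by rewrite mulr0 addr0.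
  by rewrite (px _ pr) /= mulr1 subrKC.
Qed.

End Clearing.

Theorem proposition3 (R : realType) (M : market R) (x : allocation M)
    (pi : carrier -> R) :
  optimal_solution x ->
  optimal_prices M pi ->
  forall (co1 : ge_order M) (co2 : gh_order M),
    (co1, co2) \in pro_rata M ->
    solves_participant_program pi co1 co2 (ge_ratio x co1, gh_ratio x co2).
Proof.
move=> x_opt pi_opt co1 co2 pr.
have [nbx x_max] := lagrangian_optimal x_opt pi_opt.
have [px _ gex _] := nbx; have /= <- := px _ pr.
have /andP[x_ge0 x_le1] := gex co1.
split=> [//|[t _] [/= t_le1 _ <- t_ge0 _]].
have /x_max : non_balance_constraints
    (alloc_comb x (t - ge_ratio x co1) (pair_alloc co1 co2)).
  by apply: pair_alloc_feasible => //; rewrite t_ge0.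
(* The Lagrangian changes by [t - ge_ratio x co1] times the profit at [(1, 1)], which is exactly the
   difference of the two profits. *)
rewrite lagrangian_comb lagrangian_pair_alloc /participant_profit /=; lra.
Qed.
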